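(* Consider the densities $\delta(\mathcal{C}^2_a(t))$ of the hyp-hor coverings of type 2 of the hyperbolic plane $\mathbb{H}^2$ (defined in the context), over all admissible parameters $(a,t)$. The infimum of $\delta(\mathcal{C}^2_a(t))$ over all admissible $(a,t)$ equals $\frac{\sqrt{12}}{\pi}$, and it is approached for $t\approx 1.142$ and $a\to 0$: there is a value $t_0\approx 1.142$ (i.e. $1.142\le t_0<1.143$) such that $$\lim_{a\to0^+}\delta\left(\mathcal{C}^2_a(t_0)\right)=\frac{\sqrt{12}}{\pi}.$$ That is, the value $\frac{\sqrt{12}}{\pi}$ (the universal lower bound of covering densities in $\mathbb{H}^2$) can be approximated arbitrarily accurately by the densities of hyp-hor coverings of type 2.
   Context: Use the Beltrami-Cayley-Klein disc model of the hyperbolic plane $\mathbb{H}^2$ (curvature $-1$), with homogeneous coordinates $(1,x,y)$ and absolute $x^2+y^2=1$. For $0<a<1$ let $A_0=(1,0,1)$ (an ideal point), $A_1=(1,0,0)$, $A_2=(1,\frac1a,0)$ (an outer point), and let $\pi$ be the polar line $x=a$ of $A_2$. Put $P_0=\pi\cap A_0A_2=(1,a,1-a^2)$ and $P_1=\pi\cap A_1A_2=(1,a,0)$. The Lambert quadrilateral $\mathcal{F}_a=A_0A_1P_1P_0$ has right angles at $A_1,P_1,P_0$ and angle $0$ at $A_0$; its area is $\frac{\pi}{2}$. Its images under the group generated by reflections in its sides tile $\mathbb{H}^2$. Covering $\mathcal{C}^2_a(t)$ (type 2): take the horocycle centered at $A_0$ that meets the line $A_0P_0$ in the point $(1,ta,1-ta^2)$,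 where $0<t<\frac{2}{1+2a^2-a^4}$, and suppose that it meets the side $P_0P_1$ of $\mathcal{F}_a$ in a point $M=(1,a,m)$ with $0<m\le 1-a^2$. A pair $(a,t)$ with $0<a<1$, $0<t<\frac{2}{1+2a^2-a^4}$, for which such a point $M$ exists is called admissible. Take the hypercycle with base line $A_1P_1$ through $M$, i.e. the curve at constant distance $h_2=d(M,P_1)$ from the line $A_1P_1$. The horocycle piece $\mathfrak{H}_a(t)$ is the part of the horodisc lying between the lines $A_0A_1$ and $A_0P_0$; its area equals the length of the horocycle arc between these two lines. The hypercycle piece $\mathcal{H}_a(t)$ is the region between the segment $A_1P_1$ and the hypercycle (on the side of $A_1P_1$ containing $\mathcal{F}_a$), bounded laterally by the perpendiculars to $A_1P_1$ at $A_1$ and $P_1$; its area is $d(A_1,P_1)\sinh h_2$. The two pieces together cover $\mathcal{F}_a$, and their images under the reflection group form the covering $\mathcal{C}^2_a(t)$ of $\mathbb{H}^2$. Its density is $$\delta(\mathcal{C}^2_a(t))=\frac{Vol(\mathcal{H}_a(t))+Vol(\mathfrak{H}_a(t))}{Vol(\mathcal{F}_a)},$$ where $Vol$ is hyperbolic area; explicitly $$\delta(\mathcal{C}_a^2(t))=\frac{2}{\pi}\left[\operatorname{arccosh}\left(\tfrac{1}{\sqrt{1-a^2}}\right)\sinh h_2+2\sinh\left(\tfrac{1}{2}\operatorname{arccosh}\left(\tfrac{2ta^2+t-4}{2t-4+2ta^2}\right)\right)\right].$$ *)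

(* Defs.v *)
From HB Require Import structures.
From mathcomp Require Import all_boot all_order all_algebra.
From mathcomp Require Import all_classical all_reals all_analysis.

Set Implicit Arguments.
Unset Strict Implicit.
Unset Printing Implicit Defensive.

Import Order.TTheory GRing.Theory Num.Theory.
Import numFieldNormedType.Exports.

Local Open Scope classical_set_scope.
Local Open Scope ring_scope.

(** * The hyperbolic plane in the Beltrami-Cayley-Klein disc model

    A pair [(x, y)] stands for the point with homogeneous coordinates
    [(1, x, y)]; the absolute is the unit circle. *)

Definition kpoint (R : realType) : Type := (R * R)%type.

(* Lorentz form of the representatives [(1, x, y)]: negative on the
   hyperbolic plane, zero at ideal points. *)
Definition lorentz (R : realType) (p q : kpoint R) : R :=
  p.1 * q.1 + p.2 * q.2 - 1.

Definition hplane (R : realType) : set (kpoint R) :=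
  [set p | lorentz p p < 0].

Definition arcosh (R : realType) (x : R) : R :=
  ln (x + Num.sqrt (x ^+ 2 - 1)).

Definition hdist (R : realType) (p q : kpoint R) : R :=
  arcosh (- lorentz p q / Num.sqrt (lorentz p p * lorentz q q)).

(* The sign of [orient p q r] tells on which side of the line [pq] the point
   [r] lies; it is 0 exactly when the three points are collinear. *)
Definition orient (R : realType) (p q r : kpoint R) : R :=
  (q.1 - p.1) * (r.2 - p.2) - (q.2 - p.2) * (r.1 - p.1).

(* In this model hyperbolic lines are chords of the disc; [p] and [q] need not
   be in [hplane]. *)
Definition hline (R : realType) (p q : kpoint R) : set (kpoint R) :=
  [set r | hplane r /\ orient p q r = 0].

(* Closed half-plane on the left of the line from [p] to [q]. *)
Definition halfplane (R : realType) (p q : kpoint R) : set (kpoint R) :=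
  [set r | hplane r /\ 0 <= orient p q r].

Definition hdist_line (R : realType) (p : kpoint R) (L : set (kpoint R)) : R :=
  inf [set hdist p q | q in L].

(* The horocycle centred at the ideal point [c] through [q] is the level set
   through [q] of the Busemann function at [c], which is the logarithm of
   [- lorentz p c / sqrt (- lorentz p p)]; the horodisc is the corresponding
   sublevel set. Denominators are cleared below. *)
Definition horocycle (R : realType) (c q : kpoint R) : set (kpoint R) :=
  [set p | hplane p /\
    lorentz p c ^+ 2 * (- lorentz q q) = lorentz q c ^+ 2 * (- lorentz p p)].

Definition horodisc (R : realType) (c q : kpoint R) : set (kpoint R) :=
  [set p | hplane p /\
    lorentz p c ^+ 2 * (- lorentz q q) <= lorentz q c ^+ 2 * (- lorentz p p)].

(* The Riemannian area element of the Klein model in curvature -1 is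
   [dx dy / (1 - x^2 - y^2)^(3/2)]. *)
Definition harea (R : realType) (A : set (kpoint R)) : R :=
  \int[(@lebesgue_measure R \x @lebesgue_measure R)%E]_(p in
      (A : set (measurableTypeR R * measurableTypeR R)))
    (Num.sqrt (- lorentz p p) ^+ 3)^-1.

(** * The Lambert quadrilateral *)

Definition A0 (R : realType) : kpoint R := (0, 1).
Definition A1 (R : realType) : kpoint R := (0, 0).

(* The line [P0 P1], [x = a], is the polar of the outer point [A2 = (1/a, 0)];
   [P0] and [P1] are its intersections with [A0 A2] and [A1 A2]. *)
Definition P0 (R : realType) (a : R) : kpoint R := (a, 1 - a ^+ 2).
Definition P1 (R : realType) (a : R) : kpoint R := (a, 0).

(* [A0], [A1], [P1], [P0] is the counterclockwise order of the vertices. *)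
Definition lambert (R : realType) (a : R) : set (kpoint R) :=
  halfplane (A0 R) (A1 R) `&` halfplane (A1 R) (P1 a) `&`
  halfplane (P1 a) (P0 a) `&` halfplane (P0 a) (A0 R).

(** * Hyp-hor coverings of type 2 *)

(* On the line [A0 P0], since [x = (1 - y) / a]. *)
Definition horo_pt (R : realType) (a t : R) : kpoint R :=
  (t * a, 1 - t * a ^+ 2).

(* [(a, m)] is a point [M] where the horocycle meets the side [P0 P1]. *)
Definition meets_at (R : realType) (a t m : R) : Prop :=
  0 < m <= 1 - a ^+ 2 /\ horocycle (A0 R) (horo_pt a t) (a, m).

Definition admissible (R : realType) (a t : R) : Prop :=
  [/\ 0 < a < 1, 0 < t < 2 / (1 + 2 * a ^+ 2 - a ^+ 4) &
      exists m, meets_at a t m].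

(* For admissible [(a, t)] the point [M] is unique. *)
Definition M (R : realType) (a t : R) : kpoint R :=
  (a, get [set m | meets_at a t m]).

Definition horo_piece (R : realType) (a t : R) : set (kpoint R) :=
  horodisc (A0 R) (horo_pt a t) `&`
  halfplane (A0 R) (A1 R) `&` halfplane (P0 a) (A0 R).

(* The quadrilateral has right angles at [A1] and [P1], so its sides [A0 A1]
   and [P1 P0] carry the perpendiculars to [A1 P1] at [A1] and [P1]. *)
Definition hyper_piece (R : realType) (a t : R) : set (kpoint R) :=
  [set p | hdist_line p (hline (A1 R) (P1 a)) <= hdist (M a t) (P1 a)] `&`
  halfplane (A1 R) (P1 a) `&`
  halfplane (A0 R) (A1 R) `&` halfplane (P1 a) (P0 a).

Definition density (R : realType) (a t : R) : R :=
  (harea (hyper_piece a t) + harea (horo_piece a t)) / harea (lambert a).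

Definition densities (R : realType) : set R :=
  [set d | exists a t : R, admissible a t /\ d = density a t].
Arguments densities R : clear implicits.

(* Main.v *)
Require Import Defs.
From HB Require Import structures.
From mathcomp Require Import all_boot all_order all_algebra.
From mathcomp Require Import all_classical all_reals all_analysis.
From mathcomp Require Import measurable_realfun.
From mathcomp Require Import ring lra.
Import Order.TTheory GRing.Theory Num.Theory.
Import numFieldNormedType.Exports.
Local Open Scope classical_set_scope.
Local Open Scope ring_scope.

(** Send the ideal vertex A0 to infinity: u = x / (1 - y) and
    v^2 = (1 - x^2 - y^2) / (1 - y)^2 are upper half-plane coordinates, with area
    element du dv / v^2. The lines through A0 are the verticals, A0 A1 being u = 0
    and A0 P0 being u = 1/a, and the horodisc is v^2 >= k for a number k
    ([horo_level]). Hence the horocycle piece has area 1 / (a sqrt k)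
    ([harea_horo_piece]), and integrating du/v along the floor of the
    quadrilateral gives its area pi/2 ([harea_lambert]). In slices perpendicular
    to A1 P1, the hypercycle piece has area L m / sqrt (1 - a^2 - m^2), where
    M = (a, m) and L is the length of A1 P1 ([harea_hyper_piece]). As M is on the
    horocycle,
    (1 - m)^2 k = 1 - a^2 - m^2, so that ([density_eq])

      density = 2 / (pi sqrt k) * (m L / (1 - m) + 1 / a).

    Lower bound ([density_ge]). As L >= a, it is enough to bound
    m a / (1 - m) + 1/a from below by sqrt (3 k). Clearing denominators, with
    q = 1 - a^2, this is (1 - m q)^2 >= 3 (1 - q) (q - m^2), and
    (q^2 - 3 q + 3) ((1 - m q)^2 - 3 (1 - q) (q - m^2))
    = ((q^2 - 3 q + 3) m - q)^2 + 3 (q - 1)^4.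

    The bound is approached as a tends to 0 ([density_eight_sevenths_cvg]). For
    fixed t, put w = sqrt (1 - (2/t - 1)) = sqrt (2 - 2/t); the density then tends
    to (2 / pi) (2 - w) / sqrt (1 - w^2), whose minimum sqrt 12 / pi is at w = 1/2,
    that is t = 8/7. For this t the point M is explicit, m = 1 - 2 a^2, and so is
    the density up to L, which the bounds a <= L <= a / (1 - a^2) control. *)

Notation plane R := (measurableTypeR R * measurableTypeR R)%type.

(** * Measure and integration on the line *)

Lemma measurable_invr (R : realType) : measurable_fun [set: R] (@GRing.inv R).
Proof.
have -> : [set: R] = ~` [set 0] `|` [set 0] by rewrite setUC setUv.
apply/measurable_funU; first by apply: measurableC; exact: measurable_set1.
  exact: measurable_set1.
split; last exact: measurable_fun_set1.
apply: open_continuous_measurable_fun.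
  by rewrite openC; exact: closed_eq.
move=> x; rewrite inE/= => /eqP x0; exact: inv_continuous.
Qed.

Lemma measurable_sqrtr (R : realType) : measurable_fun [set: R] (@Num.sqrt R).
Proof. by apply: continuous_measurable_fun; exact: sqrt_continuous. Qed.

(** Multiplying by c the image of Lebesgue measure under [x |-> c x] gives back
    the length of every half-open interval, hence Lebesgue measure. *)
Lemma ge0_integral_scale (R : realType) (c : R) (f : R -> \bar R) : 0 < c ->
  measurable_fun [set: R] f -> (forall x, 0 <= f x)%E ->
  (\int[lebesgue_measure]_x f x = c%:E * \int[lebesgue_measure]_x f (c * x)%R)%E.
Proof.
move=> c0 mf f0.
pose phi : measurableTypeR R -> measurableTypeR R := ( *%R c : R -> R).
have mphi : measurable_fun [set: measurableTypeR R] phi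
  by exact: (measurable_funM (measurable_cst c) (@measurable_id _ R setT)).
pose nu_of : {measure set (measurableTypeR R) -> \bar R} :=
  mscale (NngNum (ltW c0)) (pushforward lebesgue_measure phi).
pose nu := nu_of mphi.
have nuE A : measurable A -> lebesgue_measure A = nu A.
  apply: lebesgue_measure_unique => _ [[a b] _ <-].
  rewrite /nu/= /mscale/= /pushforward.
  have -> : phi @^-1` `]a, b] = `](a / c), (b / c)]%classic.
    apply/seteqP; split => x/=; rewrite !in_itv/= /phi ltr_pdivrMr// ler_pdivlMr//;
    by rewrite mulrC.
  rewrite !lebesgue_measure_itv/= !lte_fin ltr_pM2r ?invr_gt0//.
  case: ifPn => _; last by rewrite mule0.
  by rewrite -!EFinB -EFinM -mulrBl mulrCA divff ?mulr1// gt_eqF.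
transitivity (\int[nu]_x f x)%E.
  by apply: eq_measure_integral => A mA _; exact: nuE.
rewrite ge0_integral_mscale//=.
by rewrite ge0_integral_pushforward.
Qed.

(** [f] may be unbounded at [b]: the integral is the limit of the integrals over
    the compact intervals [[a, b - 1/n]]. *)
Lemma ge0_continuous_FTC2_co (R : realType) (f F : R -> R) (a b : R) : a < b ->
  (forall x, a <= x < b -> 0 <= f x) ->
  (forall x, a <= x < b -> {for x, continuous f}) ->
  (forall x, a <= x < b -> is_derive x 1 F (f x)) ->
  F x @[x --> b^'-] --> F b ->
  (\int[lebesgue_measure]_(x in `[a, b[) (f x)%:E = (F b)%:E - (F a)%:E)%E.
Proof.
move=> ab f0 cf dF Fb.
pose c (n : nat) : R := b - n.+1%:R^-1.
have cvgc : c n @[n --> \oo] --> b.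
  rewrite -[X in _ --> X]subr0; apply: cvgB; first exact: cvg_cst.
  exact: cvg_harmonic.
have cb n : c n < b by rewrite gtrBl invr_gt0 ltr0n.
have incl n : `[a, c n] `<=` [set x | a <= x < b].
  by move=> x/=; rewrite in_itv/= => /andP[-> xb]; exact: le_lt_trans (cb n).
have contF x : a <= x < b -> {for x, continuous F}.
  by move=> /dF[Fx _]; exact/differentiable_continuous/derivable1_diffP.
have cfc n : {within `[a, c n], continuous f}.
  by apply: continuous_in_subspaceT => x /set_mem/incl; exact: cf.
have lim1 : (\int[lebesgue_measure]_(x in `[a, c n]) (f x)%:E @[n --> \oo] -->
    \int[lebesgue_measure]_(x in `[a, b[) (f x)%:E)%E.
  rewrite itv_bnd_open_bigcup; apply: ge0_nondecreasing_set_cvg_integral => //.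
  - move=> m n mn; rewrite subsetEset => x/=; rewrite !in_itv/= => /andP[-> xb]/=.
    by apply: (le_trans xb); rewrite lerB// lef_pV2 ?posrE ?ltr0n// ler_nat.
  - by move=> n; apply/measurable_EFinP;
    exact: (subspace_continuous_measurable_fun (measurable_itv _) (cfc n)).
  - by move=> n x /incl xab; rewrite lee_fin f0.
rewrite -(cvg_lim _ lim1)//; apply/cvg_lim => //.
have : ((F (c n))%:E - (F a)%:E @[n --> \oo] --> (F b)%:E - (F a)%:E)%E.
  apply: cvgeB => //; last exact: cvg_cst.
  apply: cvg_EFin; first exact: nearW.
  exact: (cvg_at_leftP _ _ _).1 Fb _ (conj cb cvgc).
apply: cvg_trans; apply: near_eq_cvg => /=.
have : \forall n \near \oo, a < c n by apply: (cvgr_gt _ cvgc).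
apply: filterS => n an; apply/esym/continuous_FTC2 => //.
- split.
  + move=> x; rewrite in_itv/= => /andP[ax xb].
    by have /dF[] : a <= x < b by rewrite (ltW ax) (lt_trans xb).
  + by apply/cvg_at_right_filter/contF; rewrite lexx.
  + by apply/cvg_at_left_filter/contF; rewrite (ltW an) cb.
- move=> x; rewrite in_itv/= => /andP[ax xb].
  have /dF Fx : a <= x < b by rewrite (ltW ax) (lt_trans xb).
  by rewrite derive1E derive_val.
Qed.

(** * Areas by vertical slices towards the cusp A0 *)

Definition area_density {R : realType} (p : R * R) : R :=
  (Num.sqrt (- lorentz p p) ^+ 3)^-1.

Lemma measurable_area_density (R : realType) :
  measurable_fun [set: plane R]
    (@area_density R : plane R -> measurableTypeR R).
Proof.
rewrite /area_density /lorentz.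
apply: (measurableT_comp (@measurable_invr R)).
apply: measurable_funX.
apply: (measurableT_comp (@measurable_sqrtr R)).
apply: measurable_funN; apply: measurable_funB => //.
apply: measurable_funD; apply: measurable_funM;
  solve [exact: measurable_fst | exact: measurable_snd].
Qed.

Lemma is_derive_inv {R : realType} {f : R -> R} {x df : R} : f x != 0 ->
  is_derive x 1 f df -> is_derive x 1 (fun y => (f y)^-1) (- (f x) ^- 2 * df).
Proof.
move=> fx0 [fx <-]; apply: DeriveDef; first exact: derivableV.
by rewrite deriveV.
Qed.

Lemma lorentz_cusp {R : realType} (u y : R) :
  - lorentz (u * (1 - y), y) (u * (1 - y), y) =
  (1 - y) * (1 + y - u ^+ 2 * (1 - y)).
Proof. by rewrite /lorentz/=; ring. Qed.

(** In the half-plane coordinates (u, v) the ray is vertical and goes up to the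
    cusp, and the integrand is the [du dv / v^2] area element; the integral is
    1/v at the foot of the ray, and -1/v is the antiderivative used. *)
Lemma integral_area_density_ray (R : realType) (u y0 : R) :
  y0 < 1 -> 0 < 1 + y0 - u ^+ 2 * (1 - y0) ->
  (\int[lebesgue_measure]_(y in `[y0, 1%R[) ((1 - y) * area_density (u * (1 - y), y))%R%:E =
   (Num.sqrt ((1 - y0) / (1 + y0 - u ^+ 2 * (1 - y0))))%R%:E)%E.
Proof.
move=> y01 d0.
pose g (y : R) : R := (1 - y) / (1 + y - u ^+ 2 * (1 - y)).
have dpos y : y0 <= y -> 0 < 1 + y - u ^+ 2 * (1 - y).
  move=> yy; apply: (lt_le_trans d0); have := sqr_ge0 u; nra.
pose p (z : R) : R := 1 - z; pose d (z : R) : R := 1 + z - u ^+ 2 * (1 - z).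
have dp (y : R) : is_derive y 1 p (- 1).
  apply: is_derive_eq; ring.
have dd (y : R) : is_derive y 1 d (1 + u ^+ 2).
  apply: is_derive_eq; rewrite /GRing.scale/=; ring.
have cp (y : R) : {for y, continuous p}.
  by apply/differentiable_continuous/derivable1_diffP; case: (dp y).
have cd (y : R) : {for y, continuous d}.
  by apply/differentiable_continuous/derivable1_diffP; case: (dd y).
have cg (y : R) : 0 < d y -> {for y, continuous g}.
  move=> dy; apply: continuousM => //.
  by apply: continuousV => //; rewrite gt_eqF.
pose f (y : R) : R := p y / Num.sqrt (p y * d y) ^+ 3.
transitivity (\int[lebesgue_measure]_(y in `[y0, 1%R[) (f y)%:E)%E.
  by apply: eq_integral => y _; rewrite /area_density lorentz_cusp.
transitivity ((- Num.sqrt (g 1))%:E - (- Num.sqrt (g y0))%:E)%E; last first.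
  by rewrite /g subrr mul0r sqrtr0 oppr0 -EFinB sub0r opprK.
apply: (@ge0_continuous_FTC2_co _ _ (fun y => - Num.sqrt (g y))) => //.
- move=> y /andP[y0y y1]; apply: divr_ge0; first by rewrite /p; lra.
  by rewrite exprn_ge0// sqrtr_ge0.
- move=> y /andP[y0y y1]; have d1 := dpos y y0y.
  apply: continuousM; first exact: cp.
  apply: continuousV.
    by rewrite expf_neq0// sqrtr_eq0 -ltNge mulr_gt0// /p; lra.
  apply: (@continuous_comp _ _ _ (fun y => Num.sqrt (p y * d y)) (fun x => x ^+ 3));
    last exact: exprn_continuous.
  apply: (@continuous_comp _ _ _ (p \* d) Num.sqrt); last exact: sqrt_continuous.
  by apply: continuousM; [exact: cp|exact: cd].
- move=> y /andP[y0y y1]; have d1 : 0 < d y := dpos y y0y.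
  have p1 : 0 < p y by rewrite /p; lra.
  have gpos : 0 < g y by rewrite divr_gt0.
  have dg : is_derive y 1 g (- 2 / d y ^+ 2).
    have dV := is_derive_inv (lt0r_neq0 d1) (dd y).
    apply: is_derive_eq (is_deriveM (dp y) dV) _.
    rewrite /GRing.scale/= -[in RHS](_ : d y + (1 + u ^+ 2) * p y = 2); last first.
      by rewrite /d /p; ring.
    by field; rewrite gt_eqF.
  have dF := is_derive1_comp (is_derive1_sqrt gpos) dg.
  apply: is_derive_eq (is_deriveN dF) _.
  rewrite /f -[g y]/(p y / d y) sqrtrM ?(ltW p1)// sqrtrV ?(ltW d1)// sqrtrM ?(ltW p1)//.
  have A0 : 0 < Num.sqrt (p y) by rewrite sqrtr_gt0.
  have B0 : 0 < Num.sqrt (d y) by rewrite sqrtr_gt0.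
  rewrite -{2}(sqr_sqrtr (ltW p1)) -{2}(sqr_sqrtr (ltW d1)).
  by field; rewrite !gt_eqF.
- apply: cvg_at_left_filter.
  apply: cvgN; apply: (@continuous_comp _ _ _ g Num.sqrt); last exact: sqrt_continuous.
  by apply: cg; rewrite /d; lra.
Qed.

Lemma area_density_ge0 {R : realType} (p : R * R) : 0 <= area_density p.
Proof. by rewrite /area_density invr_ge0 exprn_ge0// sqrtr_ge0. Qed.

(** The extension by zero, for exchanging integrals over the whole plane. *)
Definition area_on {R : realType} (D : set (R * R)) : R * R -> \bar R :=
  (fun p => (area_density p)%:E) \_ D.

Lemma area_on_ge0 {R : realType} (D : set (R * R)) p : (0 <= area_on D p)%E.
Proof.
by apply: erestrict_ge0 => q _; rewrite lee_fin area_density_ge0.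
Qed.

Lemma measurable_area_on {R : realType}
    {D : set (plane R)} :
  measurable D -> measurable_fun [set: plane R]
    (area_on D : plane R -> \bar R).
Proof.
move=> mD; apply/(measurable_restrictT _ mD).
apply/measurable_EFinP.
apply: measurable_funS (measurable_area_density R) => //.
Qed.

(** For fixed y the substitution x = u (1 - y) is a scaling. Integrating first
    in x, scaling, and then exchanging the order of integration leads to the
    vertical rays of [integral_area_density_ray] without a change of variables
    in the plane. The hypothesis on D says that it is the part of the strip
    between the verticals u = 0 and u = U above the graph of y0. *)
Lemma integral_area_cusp {R : realType}
    {D : set (plane R)} {y0 : R -> R} {U : R} :
  measurable D ->
  (forall u, 0 <= u <= U -> y0 u < 1 /\ 0 < 1 + y0 u - u ^+ 2 * (1 - y0 u)) ->
  (forall p, D p -> p.2 < 1) ->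
  (forall u y, D (u * (1 - y), y) <-> 0 <= u <= U /\ y0 u <= y < 1) ->
  (\int[lebesgue_measure \x lebesgue_measure]_(p in D) (area_density p)%:E =
   \int[lebesgue_measure]_(u in `[0%R, U])
     (Num.sqrt ((1 - y0 u) / (1 + y0 u - u ^+ 2 * (1 - y0 u))))%:E)%E.
Proof.
move=> mD Hy0 D1 HD.
pose phi (p : plane R) :
  plane R := (p.1 * (1 - p.2) : R, p.2).
have mphi : measurable_fun setT phi.
  apply/measurable_fun_pair; last exact: measurable_snd.
  apply: measurable_funM; first exact: measurable_fst.
  by apply: measurable_funB => //; exact: measurable_snd.
pose g (p : plane R) : \bar R :=
  ((1 - p.2)%:E * area_on D (phi p))%E.
have gE u y : g (u, y) =
    (fun p : R * R =>
      ((1 - p.2) * area_density ((p.1 * (1 - p.2))%R, p.2))%:E) \_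
    [set p | 0 <= p.1 <= U /\ y0 p.1 <= p.2 < 1] (u, y).
  rewrite /g /area_on !patchE/=; case: ifPn => [/set_mem/= /HD|/negP] h.
    by rewrite mem_set// EFinM.
  by rewrite mule0 memNset// => /HD /mem_set.
(* The factor 1 - y is negative beyond y = 1, but D does not reach there. *)
have g0 p : (0 <= g p)%E.
  case: p => u y; rewrite gE; apply: erestrict_ge0 => -[{}u {}y]/= [_ /andP[_ y1]].
  by rewrite lee_fin mulr_ge0 ?area_density_ge0// subr_ge0 ltW.
have mg : measurable_fun setT g.
  apply: emeasurable_funM.
    by apply/measurable_EFinP; apply: measurable_funB => //; exact: measurable_snd.
  exact: (measurableT_comp (measurable_area_on mD) mphi).
rewrite integral_mkcond -/(area_on D) fubini_tonelli2; last 2 first.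
- exact: measurable_area_on.
- by move=> p; exact: area_on_ge0.
rewrite /fubini_G.
transitivity (\int[lebesgue_measure]_y \int[lebesgue_measure]_u g (u, y))%E.
  apply: eq_integral => y _.
  have [y1|y1] := ltP y 1; last first.
    rewrite !integral0_eq// => x _.
      rewrite /g /area_on patchE memNset ?mule0// => /D1/=.
      by rewrite ltNge y1.
    by rewrite /area_on patchE memNset// => /D1/=; rewrite ltNge y1.
  have msec : measurable_fun [set: measurableTypeR R]
      (fun x : measurableTypeR R => area_on D (x, y)).
    apply: (measurableT_comp (measurable_area_on mD)).
    exact: (measurable_fun_pair (measurable_id (D := setT)) (measurable_cst y)).
  rewrite (ge0_integral_scale R (1 - y) (fun x => area_on D (x, y)) _ msec) ?subr_gt0//;
    last by move=> x; exact: area_on_ge0.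
  rewrite -ge0_integralZl//.
  - by apply: eq_integral => x _; rewrite /g/= mulrC.
  - by apply: (measurableT_comp msec); exact: measurable_funM.
  - by move=> x _; exact: area_on_ge0.
  - by rewrite lee_fin subr_ge0 ltW.
transitivity (\int[lebesgue_measure]_u \int[lebesgue_measure]_y g (u, y))%E.
  exact/esym/fubini_tonelli.
rewrite [RHS]integral_mkcond; apply: eq_integral => u _.
rewrite patchE; case: ifPn => [/set_mem/=|/negP] h.
  have [y01 d0] := Hy0 _ h; rewrite -integral_area_density_ray//.
  rewrite [RHS]integral_mkcond; apply: eq_integral => y _.
  rewrite gE !patchE.
  congr (if _ then _ else _); apply/idP/idP => [/set_mem/= [_ yI]|/set_mem yI];
    by apply/mem_set => //=; split.
apply: integral0_eq => y _.
by rewrite gE patchE memNset//= => -[uU _]; apply: h; exact/mem_set.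
Qed.

(** * Areas by slices perpendicular to the line y = 0 *)

(** With s = c / sqrt (1 - c^2), the sinh of the height of the hypercycle
    y = c sqrt (1 - x^2), this is s times the length element of the line y = 0
    at x. *)
Lemma integral_area_density_segment (R : realType) (x c : R) :
  0 < c < 1 -> x ^+ 2 < 1 ->
  (\int[lebesgue_measure]_(y in `[0%R, (c * Num.sqrt (1 - x ^+ 2))%R])
      (area_density (x, y))%:E =
   (c / Num.sqrt (1 - c ^+ 2) * (1 - x ^+ 2)^-1)%:E)%E.
Proof.
move=> /andP[c0 c1] x1; set w := 1 - x ^+ 2; set b := (c * _)%R.
have w0 : 0 < w by rewrite subr_gt0.
have b0 : 0 < b by rewrite mulr_gt0// sqrtr_gt0.
have b2 : b ^+ 2 = c ^+ 2 * w by rewrite exprMn sqr_sqrtr// ltW.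
pose s (y : R) : R := w - y ^+ 2.
have s0 y : 0 <= y <= b -> 0 < s y.
  move=> /andP[y0 yb]; have yb2 : y ^+ 2 <= b ^+ 2 by rewrite ler_pXn2r// nnegrE// ltW.
  rewrite subr_gt0 (le_lt_trans yb2)// b2 gtr_pMl// expr_lt1// ltW//.
pose f (y : R) : R := (Num.sqrt (s y) ^+ 3)^-1.
(* At constant x, the derivative of y / (w sqrt (w - y^2)) is
   (w - y^2)^(-3/2). *)
pose F (y : R) : R := y * (w * Num.sqrt (s y))^-1.
have ds (y : R) : is_derive y 1 s (- 2 * y).
  by apply: is_derive_eq; rewrite /GRing.scale/=; ring.
have dF y : 0 <= y <= b -> is_derive y 1 F (f y).
  move=> /s0 sy.
  have A0 : 0 < Num.sqrt (s y) by rewrite sqrtr_gt0.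
  have dq := is_derive1_comp (is_derive1_sqrt sy) (ds y).
  have q0 : w * Num.sqrt (s y) != 0 by rewrite mulf_neq0// gt_eqF.
  have dwq := is_deriveM (is_derive_cst w y 1) dq.
  have dI := @is_derive_inv R (fun y : R => w * Num.sqrt (s y)) y _ q0 dwq.
  apply: is_derive_eq (is_deriveM (is_derive_id y 1) dI) _.
  rewrite /GRing.scale/= /f.
  have wE : w = Num.sqrt (s y) ^+ 2 + y ^+ 2 by rewrite sqr_sqrtr ?(ltW sy)// /s; ring.
  by rewrite wE; field; rewrite -wE !gt_eqF.
have contF y : 0 <= y <= b -> {for y, continuous F}.
  by move=> /dF[Fx _]; exact/differentiable_continuous/derivable1_diffP.
have contf (y : R) : 0 <= y <= b -> {for y, continuous f}.
  move=> /s0 sy.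
  apply: continuousV; first by rewrite expf_neq0// sqrtr_eq0 -ltNge.
  apply: (@continuous_comp _ _ _ (fun y => Num.sqrt (s y)) (fun x => x ^+ 3));
    last exact: exprn_continuous.
  apply: (@continuous_comp _ _ _ s Num.sqrt); last exact: sqrt_continuous.
  by apply/differentiable_continuous/derivable1_diffP; case: (ds y).
transitivity ((F b)%:E - (F 0)%:E)%E; last first.
  rewrite /F mul0r sube0 /s b2 -{2}[w]mul1r -mulrBl sqrtrM;
    last by rewrite subr_ge0 expr_le1// ltW.
  rewrite /b; congr EFin.
  have W0 : 0 < Num.sqrt w by rewrite sqrtr_gt0.
  have C0 : 0 < Num.sqrt (1 - c ^+ 2) by rewrite sqrtr_gt0 subr_gt0 expr_lt1// ltW.
  by field; rewrite !gt_eqF.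
transitivity (\int[lebesgue_measure]_(y in `[0%R, b]) (f y)%:E)%E.
  apply: eq_integral => y _; rewrite /area_density /f /s /lorentz/=.
  congr ((Num.sqrt _ ^+ 3)^-1)%:E.
  by rewrite /w; ring.
apply: continuous_FTC2 => //.
- apply: continuous_in_subspaceT => y; rewrite inE/= in_itv/=; exact: contf.
- split.
  + move=> y; rewrite in_itv/= => /andP[/ltW y0 /ltW yb].
    by have /dF[] : 0 <= y <= b by rewrite y0.
  + by apply/cvg_at_right_filter/contF; rewrite lexx ltW.
  + by apply/cvg_at_left_filter/contF; rewrite lexx ltW.
- move=> y; rewrite in_itv/= => /andP[/ltW y0 /ltW yb].
  have /dF Fx : 0 <= y <= b by rewrite y0.
  by rewrite derive1E derive_val.
Qed.

Lemma integral_area_strip {R : realType}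
    {D : set (plane R)} {a c : R} :
  measurable D -> a < 1 -> 0 < c < 1 ->
  (forall x y, D (x, y) <-> 0 <= x <= a /\ 0 <= y <= c * Num.sqrt (1 - x ^+ 2)) ->
  (\int[lebesgue_measure \x lebesgue_measure]_(p in D) (area_density p)%:E =
   \int[lebesgue_measure]_(x in `[0%R, a])
     (c / Num.sqrt (1 - c ^+ 2) * (1 - x ^+ 2)^-1)%R%:E)%E.
Proof.
move=> mD a1 c01 HD.
rewrite integral_mkcond -/(area_on D) fubini_tonelli1; last 2 first.
- exact: measurable_area_on.
- by move=> p; exact: area_on_ge0.
rewrite /fubini_F [RHS]integral_mkcond; apply: eq_integral => x _.
rewrite patchE; case: ifPn => [/set_mem/=|/negP] h.
  have h' := h; move: h'; rewrite in_itv/= => /andP[x0 xa].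
  rewrite -integral_area_density_segment//; last by rewrite expr_lt1// (le_lt_trans xa).
  rewrite [RHS]integral_mkcond; apply: eq_integral => y _.
  rewrite /area_on !patchE.
  congr (if _ then _ else _); apply/idP/idP => [/set_mem/HD[_ yI]|/set_mem/= yI];
    by apply/mem_set => //; apply/HD.
apply: integral0_eq => y _.
by rewrite /area_on patchE memNset// => /HD[uU _]; apply: h; exact/mem_set.
Qed.

(** * Distance to the base line, hypercycles and measurability *)

Lemma measurable_le_set {d} {T : measurableType d} {R : realType} (f g : T -> R) :
  measurable_fun setT f -> measurable_fun setT g ->
  measurable [set p | f p <= g p].
Proof.
move=> mf mg; have := measurable_fun_ler mf mg.
move=> /(_ measurableT [set true] I); rewrite setTI; congr measurable.
Qed.

Lemma arcosh_le {R : realType} (x y : R) : 1 <= x -> 1 <= y ->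
  (arcosh x <= arcosh y) = (x <= y).
Proof.
have mono (v z : R) : 1 <= v -> v < z -> arcosh v < arcosh z.
  move=> v1 vz; rewrite /arcosh ltr_ln ?posrE.
  - by rewrite ltr_leD// ler_sqrt ?lerB//; nra.
  - by rewrite ltr_wpDr ?sqrtr_ge0//; lra.
  - by rewrite ltr_wpDr ?sqrtr_ge0//; lra.
move=> x1 y1; case: (ltgtP x y) => [xy|yx|->]; last by rewrite lexx.
  by rewrite ltW// mono.
by rewrite leNgt mono.
Qed.

Lemma inf_attained {R : realType} (A : set R) (x : R) :
  A x -> lbound A x -> inf A = x.
Proof.
move=> Ax lx; apply/eqP; rewrite eq_le ge_inf//; last by exists x.
by rewrite lb_le_inf//; exists x.
Qed.

Lemma hplaneE {R : realType} (x y : R) : hplane (x, y) <-> 0 < 1 - x ^+ 2 - y ^+ 2.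
Proof. by rewrite /hplane /lorentz/=; split; lra. Qed.

(** The hyperbolic cosine of the distance from (x, y) to the line y = 0, whose
    nearest point is (x, 0). *)
Definition cosh_height {R : realType} (x y : R) : R :=
  Num.sqrt ((1 - x ^+ 2) / (1 - x ^+ 2 - y ^+ 2)).

Lemma cosh_height_ge1 {R : realType} (x y : R) : 0 < 1 - x ^+ 2 - y ^+ 2 ->
  1 <= cosh_height x y.
Proof.
move=> S0; rewrite -[leLHS]sqrtr1 ler_wsqrtr// ler_pdivlMr// mul1r.
by rewrite gerBl sqr_ge0.
Qed.

Lemma hdist_axis {R : realType} (x y : R) : 0 < 1 - x ^+ 2 - y ^+ 2 ->
  hdist (x, y) (x, 0) = arcosh (cosh_height x y).
Proof.
move=> S0; have w0 : 0 < 1 - x ^+ 2 by have := sqr_ge0 y; lra.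
rewrite /hdist /lorentz/= /cosh_height; congr arcosh.
have -> : (x * x + y * y - 1) * (x * x + 0 * 0 - 1) =
  (1 - x ^+ 2 - y ^+ 2) * (1 - x ^+ 2) by ring.
have -> : - (x * x + y * 0 - 1) = 1 - x ^+ 2 by ring.
rewrite !sqrtrM ?(ltW S0) ?(ltW w0)// sqrtrV ?(ltW S0)//.
have A0 : 0 < Num.sqrt (1 - x ^+ 2) by rewrite sqrtr_gt0.
have B0 : 0 < Num.sqrt (1 - x ^+ 2 - y ^+ 2) by rewrite sqrtr_gt0.
rewrite -{1}(sqr_sqrtr (ltW w0)); field; rewrite !gt_eqF//.
Qed.

(** That (x, 0) is the nearest point of the line comes from
    (1 - x q)^2 - (1 - x^2) (1 - q^2) = (x - q)^2. *)
Lemma hdist_line_axis {R : realType} (a x y : R) : 0 < a ->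
  0 < 1 - x ^+ 2 - y ^+ 2 ->
  hdist_line (x, y) (hline (A1 R) (P1 a)) = arcosh (cosh_height x y).
Proof.
move=> a0 S0; have w0 : 0 < 1 - x ^+ 2 by have := sqr_ge0 y; lra.
apply: inf_attained.
  exists (x, 0); last exact: hdist_axis.
  by split; [apply/hplaneE; rewrite expr0n subr0|rewrite /orient/=; ring].
move=> _ [[q q'] [/hplaneE qh aq'] <-].
have q'0 : q' = 0.
  move: aq'; rewrite /orient/= !subr0 mul0r subr0 => /eqP.
  by rewrite mulf_eq0 gt_eqF//= => /eqP.
rewrite q'0 expr0n subr0 in qh *.
have main : cosh_height x y <= - lorentz (x, y) (q, 0) /
    Num.sqrt (lorentz (x, y) (x, y) * lorentz (q, 0) (q, 0)).
  have -> : lorentz (x, y) (x, y) * lorentz (q, 0) (q, 0) =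
      (1 - q ^+ 2) * (1 - x ^+ 2 - y ^+ 2).
    by rewrite /lorentz/=; ring.
  have -> : - lorentz (x, y) (q, 0) = 1 - x * q by rewrite /lorentz/=; ring.
  have xq : 0 < 1 - x * q by nra.
  rewrite ler_pdivlMr ?sqrtr_gt0 ?mulr_gt0// /cosh_height.
  rewrite -sqrtrM ?divr_ge0 ?(ltW w0) ?(ltW S0)//.
  rewrite -[leRHS](ger0_norm (ltW xq)) -sqrtr_sqr ler_wsqrtr//.
  have -> : (1 - x ^+ 2) / (1 - x ^+ 2 - y ^+ 2) * ((1 - q ^+ 2) * (1 - x ^+ 2 - y ^+ 2)) =
    (1 - x ^+ 2) * (1 - q ^+ 2) by field; rewrite gt_eqF.
  have := sqr_ge0 (x - q); nra.
have ch1 := cosh_height_ge1 _ _ S0.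
by rewrite /hdist arcosh_le// (le_trans ch1 main).
Qed.

(** The hypercycle through (a, m) is a half-ellipse in this model. *)
Lemma cosh_height_le {R : realType} (x y a m : R) :
  0 < 1 - x ^+ 2 - y ^+ 2 -> 0 < 1 - a ^+ 2 - m ^+ 2 -> 0 <= y -> 0 < m ->
  (cosh_height x y <= cosh_height a m) =
  (y <= m / Num.sqrt (1 - a ^+ 2) * Num.sqrt (1 - x ^+ 2)).
Proof.
move=> S0 T0 y0 m0.
have w0 : 0 < 1 - x ^+ 2 by have := sqr_ge0 y; lra.
have v0 : 0 < 1 - a ^+ 2 by have := sqr_ge0 m; lra.
have W0 : 0 < Num.sqrt (1 - x ^+ 2) by rewrite sqrtr_gt0.
have V0 : 0 < Num.sqrt (1 - a ^+ 2) by rewrite sqrtr_gt0.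
have L0 : 0 <= y * Num.sqrt (1 - a ^+ 2) by rewrite mulr_ge0// ltW.
have R0 : 0 <= m * Num.sqrt (1 - x ^+ 2) by rewrite mulr_ge0// ltW.
have Q0 : 0 <= (1 - a ^+ 2) / (1 - a ^+ 2 - m ^+ 2) by rewrite divr_ge0// ltW.
rewrite mulrAC ler_pdivlMr// -[RHS]ler_sqr ?nnegrE//.
rewrite !exprMn (sqr_sqrtr (ltW w0)) (sqr_sqrtr (ltW v0)) /cosh_height ler_sqrt//.
rewrite ler_pdivlMr// mulrAC ler_pdivrMr//.
by apply/idP/idP; nra.
Qed.

Lemma measurable_lorentz {R : realType} (f g : plane R -> plane R) :
  measurable_fun setT f -> measurable_fun setT g ->
  measurable_fun setT (fun p => lorentz (f p : R * R) (g p : R * R) : measurableTypeR R).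
Proof.
move=> mf mg; apply: measurable_funB => //.
have m1 (h : plane R -> plane R) : measurable_fun setT h ->
    measurable_fun setT (fun p => (h p).1).
  by move=> mh; exact: (measurableT_comp measurable_fst mh).
have m2 (h : plane R -> plane R) : measurable_fun setT h ->
    measurable_fun setT (fun p => (h p).2).
  by move=> mh; exact: (measurableT_comp measurable_snd mh).
by apply: measurable_funD; apply: measurable_funM; [exact: m1|exact: m1|exact: m2|exact: m2].
Qed.

Lemma measurable_hplane (R : realType) : measurable (hplane (R := R) : set (plane R)).
Proof.
have -> : (hplane (R := R) : set (plane R)) =
    ~` [set p : plane R | 0 <= lorentz (p : R * R) (p : R * R)].
  by apply/seteqP; split => p /=; rewrite /hplane/= ltNge => /negP.
apply: measurableC; apply: (measurable_le_set (cst 0)) => //.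
by apply: (measurable_lorentz id id).
Qed.

Lemma measurable_halfplane {R : realType} (p q : R * R) :
  measurable (halfplane p q : set (plane R)).
Proof.
apply: measurableI; first exact: measurable_hplane.
apply: (measurable_le_set (cst 0)) => //.
apply: measurable_funB; apply: measurable_funM => //; apply: measurable_funB => //;
  by [exact: measurable_fst|exact: measurable_snd].
Qed.

Lemma measurable_horodisc {R : realType} (c q : R * R) :
  measurable (horodisc c q : set (plane R)).
Proof.
apply: measurableI; first exact: measurable_hplane.
apply: measurable_le_set; apply: measurable_funM => //.
  by apply: measurable_funX; apply: (measurable_lorentz id (cst c)).
by apply: measurable_funN; apply: (measurable_lorentz id id).
Qed.

(** * The hypercycle piece *)

(** The length artanh a of the side A1 P1. *)
Definition base_length {R : realType} (a : R) : R :=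
  \int[lebesgue_measure]_(x in `[0, a]) (1 - x ^+ 2)^-1.

Lemma base_length_integrand_bounds {R : realType} {a : R} (x : R) :
  0 < a < 1 -> 0 <= x <= a -> 1 <= (1 - x ^+ 2)^-1 <= (1 - a ^+ 2)^-1.
Proof.
move=> /andP[a0 a1] /andP[x0 xa].
have A : 0 < 1 - a ^+ 2 by nra.
have B : 1 - a ^+ 2 <= 1 - x ^+ 2 by nra.
have C : 0 < 1 - x ^+ 2 by lra.
rewrite lef_pV2 ?posrE// B andbT -[leLHS]invr1 lef_pV2 ?posrE//.
by rewrite gerBl sqr_ge0.
Qed.

Lemma integrable_base_length {R : realType} {a : R} : 0 < a < 1 ->
  (lebesgue_measure : {measure set (measurableTypeR R) -> \bar R}).-integrable
    `[0, a] (EFin \o (fun x : R => (1 - x ^+ 2)^-1)).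
Proof.
move=> /andP[a0 a1].
have contV (x : R) : 0 <= x <= a -> {for x, continuous (fun x : R => (1 - x ^+ 2)^-1)}.
  move=> /andP[x0 xa]; apply: continuousV.
    by rewrite gt_eqF//; nra.
  by apply: continuousB; [exact: cst_continuous|exact: exprn_continuous].
apply: continuous_compact_integrable; first exact: segment_compact.
by apply: continuous_in_subspaceT => x; rewrite inE/= in_itv/=; exact: contV.
Qed.

(** The lower bound is what the estimate of the density needs, and both bounds
    give base_length a ~ a at 0. *)
Lemma base_length_bounds {R : realType} (a : R) : 0 < a < 1 ->
  a <= base_length a <= a / (1 - a ^+ 2).
Proof.
move=> a01; have /andP[a0 a1] := a01.
have cst_int (r : R) : a * r = \int[lebesgue_measure]_(x in `[0, a]) (cst r x).
  rewrite Rintegral_cst//= lebesgue_measure_itv/= lte_fin a0 sube0/= mulrC//.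
have icst r : (lebesgue_measure : {measure set (measurableTypeR R) -> \bar R}).-integrable
    `[0, a] (EFin \o cst (r : R)).
  apply: continuous_compact_integrable; first exact: segment_compact.
  by apply: continuous_subspaceT => x; exact: cst_continuous.
apply/andP; split.
  rewrite -[leLHS]mulr1 cst_int; apply: le_Rintegral => //.
    exact: integrable_base_length.
  by move=> x/=; rewrite in_itv/= => /(base_length_integrand_bounds _ a01)/andP[].
rewrite cst_int; apply: le_Rintegral => //; first exact: integrable_base_length.
by move=> x/=; rewrite in_itv/= => /(base_length_integrand_bounds _ a01)/andP[].
Qed.

(** Perpendiculars to A1 P1 are the lines of constant x, so the slices are those
    of [integral_area_strip] with c = m / sqrt (1 - a^2). *)
Lemma harea_hyper_piece {R : realType} (a : R) (t m : R) : 0 < a < 1 ->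
  M a t = (a, m) -> 0 < m ->
  0 < 1 - a ^+ 2 - m ^+ 2 ->
  harea (hyper_piece a t) = m / Num.sqrt (1 - a ^+ 2 - m ^+ 2) * base_length a.
Proof.
move=> a01 ME m0 T0; have /andP[a0 a1] := a01.
have v0 : 0 < 1 - a ^+ 2 by have := sqr_ge0 m; lra.
pose c := m / Num.sqrt (1 - a ^+ 2).
have c2 : c ^+ 2 = m ^+ 2 / (1 - a ^+ 2) by rewrite expr_div_n sqr_sqrtr// ltW.
have c01 : 0 < c < 1.
  rewrite divr_gt0 ?sqrtr_gt0//= -[ltLHS]ger0_norm; last by rewrite divr_ge0 ?sqrtr_ge0 ?ltW.
  by rewrite -sqrtr_sqr c2 -[ltRHS]sqrtr1 ltr_sqrt// ltr_pdivrMr//; lra.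
have cE : c / Num.sqrt (1 - c ^+ 2) = m / Num.sqrt (1 - a ^+ 2 - m ^+ 2).
  rewrite c2; have -> : 1 - m ^+ 2 / (1 - a ^+ 2) = (1 - a ^+ 2 - m ^+ 2) / (1 - a ^+ 2).
    by field; rewrite gt_eqF.
  rewrite sqrtrM ?(ltW T0)// sqrtrV ?(ltW v0)// /c.
  have A0 : 0 < Num.sqrt (1 - a ^+ 2) by rewrite sqrtr_gt0.
  have B0 : 0 < Num.sqrt (1 - a ^+ 2 - m ^+ 2) by rewrite sqrtr_gt0.
  by field; rewrite !gt_eqF.
have piece x y : hyper_piece a t (x, y) <-> 0 <= x <= a /\ 0 <= y <= c * Num.sqrt (1 - x ^+ 2).
  have half1 : orient (A1 R) (P1 a) (x, y) = a * y by rewrite /orient/=; ring.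
  have half2 : orient (A0 R) (A1 R) (x, y) = x by rewrite /orient/=; ring.
  have half3 : orient (P1 a) (P0 a) (x, y) = (1 - a ^+ 2) * (a - x) by rewrite /orient/=; ring.
  have near : 0 < 1 - x ^+ 2 - y ^+ 2 -> 0 <= y ->
      hdist_line (x, y) (hline (A1 R) (P1 a)) <= hdist (M a t) (P1 a) ->
      y <= c * Num.sqrt (1 - x ^+ 2).
    move=> S0 y0; rewrite ME hdist_line_axis// hdist_axis// arcosh_le ?cosh_height_ge1//.
    by rewrite cosh_height_le.
  rewrite /hyper_piece /halfplane/= half1 half2 half3 pmulr_rge0// pmulr_rge0// subr_ge0.
  split=> [[[[near_xy [/hplaneE S0 y0]] [_ x0]] [_ xa]]|[/andP[x0 xa] /andP[y0 yc]]].
    by rewrite x0 xa y0 near.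
  have w0 : 0 < 1 - x ^+ 2 by nra.
  have S0 : 0 < 1 - x ^+ 2 - y ^+ 2.
    have : y ^+ 2 <= (c * Num.sqrt (1 - x ^+ 2)) ^+ 2.
      by rewrite ler_pXn2r// nnegrE (le_trans y0).
    rewrite exprMn (sqr_sqrtr (ltW w0)) => y2.
    have : c ^+ 2 < 1 by rewrite expr_lt1//; case/andP: c01 => // /ltW.
    by nra.
  have hp : hplane (x, y) by apply/hplaneE.
  have near_xy : hdist_line (x, y) (hline (A1 R) (P1 a)) <= hdist (M a t) (P1 a).
    by rewrite ME hdist_line_axis// hdist_axis// arcosh_le ?cosh_height_ge1// cosh_height_le.
  exact: (conj (conj (conj near_xy (conj hp y0)) (conj hp x0)) (conj hp xa)).
have mpiece : measurable (hyper_piece a t : set (plane R)).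
  have -> : (hyper_piece a t : set (plane R)) =
      [set p | (0 : R) <= p.1] `&` [set p | (p.1 : R) <= a] `&`
      [set p | (0 : R) <= p.2] `&` [set p | (p.2 : R) <= c * Num.sqrt (1 - p.1 ^+ 2)].
    apply/seteqP; split=> -[x y].
      by move=> /piece[/andP[? ?] /andP[? ?]].
    by move=> [[[x0 xa] y0] yc]; apply/piece; split; apply/andP.
  have m1 := @measurable_fst _ _ (measurableTypeR R) (measurableTypeR R).
  have m2 := @measurable_snd _ _ (measurableTypeR R) (measurableTypeR R).
  do 3? apply: measurableI; apply: measurable_le_set => //.
  apply: measurable_funM => //; apply: (measurableT_comp (measurable_sqrtr R)).
  by apply: measurable_funB => //; exact: measurable_funX.
rewrite /harea /Rintegral (integral_area_strip mpiece a1 c01 piece)//.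
rewrite cE -[fine _]/(\int[lebesgue_measure]_(x in `[0, a])
  (m / Num.sqrt (1 - a ^+ 2 - m ^+ 2) * (1 - x ^+ 2)^-1)).
by rewrite RintegralZl//; exact: integrable_base_length.
Qed.

(** * The horocycle piece *)

(** The value of v^2 on the horocycle, in the half-plane coordinates. *)
Definition horo_level {R : realType} (a t : R) : R :=
  (2 - t * (1 + a ^+ 2)) / (t * a ^+ 2).

Lemma hplane_lt1 {R : realType} (x y : R) : hplane (x, y) -> y < 1.
Proof. by move=> /hplaneE; have := sqr_ge0 x; nra. Qed.

Lemma hplane_cusp {R : realType} (u y : R) : y < 1 ->
  hplane (u * (1 - y), y) <-> 0 < 1 + y - u ^+ 2 * (1 - y).
Proof.
move=> y1; rewrite -(pmulr_rgt0 (x := 1 - y)) ?subr_gt0//.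
by rewrite -lorentz_cusp oppr_gt0.
Qed.

(** The side A0 P0 lies on the vertical line u = 1/a. *)
Lemma A0P0_cusp {R : realType} (a u y : R) : 0 < a -> y < 1 ->
  (0 <= 1 - y - a * (u * (1 - y))) = (u <= a^-1).
Proof.
move=> a0 y1; have y1' : 0 < 1 - y by lra.
have -> : 1 - y - a * (u * (1 - y)) = (1 - y) * (1 - a * u) by ring.
by rewrite pmulr_rge0// subr_ge0 -[a^-1]mul1r ler_pdivlMr// mulrC.
Qed.

(** In the half-plane the piece is 0 <= u <= 1/a, v >= sqrt k: a strip of width
    1/a whose vertical rays all have weight 1 / sqrt k. *)
Lemma harea_horo_piece {R : realType} (a t : R) : 0 < a -> 0 < t ->
  0 < horo_level a t ->
  harea (horo_piece a t) = (a * Num.sqrt (horo_level a t))^-1.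
Proof.
move=> a0 t0; set k := horo_level a t => k0.
have kE : t * a ^+ 2 * k = 2 - t * (1 + a ^+ 2).
  by rewrite /k /horo_level; field; rewrite !gt_eqF.
(* v^2 = (1 + y) / (1 - y) - u^2, so v^2 = k at y = y0 u. *)
pose y0 (u : R) := (k + u ^+ 2 - 1) / (k + u ^+ 2 + 1).
have n0 (u : R) : 0 < k + u ^+ 2 + 1 by have := sqr_ge0 u; lra.
have e1 (u : R) : 1 - y0 u = 2 / (k + u ^+ 2 + 1).
  by rewrite /y0; field; rewrite gt_eqF.
have e2 (u : R) : 1 + y0 u - u ^+ 2 * (1 - y0 u) = 2 * k / (k + u ^+ 2 + 1).
  by rewrite /y0; field; rewrite gt_eqF.
have ha (p : R * R) : (horodisc (A0 R) (horo_pt a t) p) <->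
    hplane p /\ (1 - p.2) ^+ 2 * k <= - lorentz p p.
  rewrite /horodisc/=.
  have -> : lorentz p (A0 R) = p.2 - 1 by rewrite /lorentz/=; ring.
  have -> : lorentz (horo_pt a t) (A0 R) = - (t * a ^+ 2) by rewrite /lorentz/=; ring.
  have -> : - lorentz (horo_pt a t) (horo_pt a t) = (t * a ^+ 2) ^+ 2 * k.
    by rewrite expr2 -mulrA kE /lorentz/=; ring.
  have c0 : 0 < (t * a ^+ 2) ^+ 2 by rewrite exprn_gt0// mulr_gt0// exprn_gt0.
  by rewrite mulrCA sqrrN ler_pM2l// -sqrrN opprB.
have mpiece : measurable (horo_piece a t : set (plane R)).
  apply: measurableI; last exact: measurable_halfplane.
  by apply: measurableI; [exact: measurable_horodisc|exact: measurable_halfplane].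
have half1 x y : orient (A0 R) (A1 R) (x, y) = x by rewrite /orient/=; ring.
have half2 x y : orient (P0 a) (A0 R) (x, y) = a * (1 - y - a * x) by rewrite /orient/=; ring.
have piece u y : horo_piece a t (u * (1 - y), y) <-> 0 <= u <= a^-1 /\ y0 u <= y < 1.
  rewrite /horo_piece /halfplane/= ha half1 half2 (pmulr_rge0 _ a0)/=.
  have key : y < 1 ->
      ((1 - y) ^+ 2 * k <= - lorentz (u * (1 - y), y) (u * (1 - y), y)) = (y0 u <= y).
    move=> y1; have y1' : 0 < 1 - y by lra.
    by rewrite lorentz_cusp expr2 -mulrA ler_pM2l// /y0 ler_pdivrMr//; apply/idP/idP; lra.
  split.
    move=> [[[/[dup] /hplane_lt1 y1 hp]]]; rewrite key// => yy [_ ux] [_].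
    rewrite A0P0_cusp// => ua.
    by rewrite ua yy y1 !andbT; split=> //; rewrite -(pmulr_lge0 _ (_ : 0 < 1 - y)) ?subr_gt0.
  move=> [/andP[u0 ua] /andP[yy y1]].
  have hp : hplane (u * (1 - y), y).
    apply/hplane_cusp => //; apply: (@lt_le_trans _ _ (1 + y0 u - u ^+ 2 * (1 - y0 u))).
      by rewrite e2 divr_gt0// mulr_gt0.
    by have := sqr_ge0 u; nra.
  rewrite key// A0P0_cusp//; do ! split => //.
  by rewrite mulr_ge0// subr_ge0 ltW.
rewrite /harea /Rintegral (integral_area_cusp mpiece _ _ piece); last 2 first.
- move=> u _; split; last by rewrite e2 divr_gt0// mulr_gt0.
  by rewrite -subr_gt0 e1 divr_gt0.
- by move=> [x y] [[[/hplane_lt1]]].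
transitivity (fine (\int[lebesgue_measure]_(u in `[0%R, (a^-1)%R])
    (cst ((Num.sqrt k)^-1)%R%:E u))%E).
  congr fine; apply: eq_integral => u _; rewrite e2 e1 -sqrtrV ?ltW//; congr (Num.sqrt _)%:E.
  by field; rewrite !gt_eqF.
rewrite integral_cst//= lebesgue_measure_itv/= lte_fin invr_gt0 a0 sube0/= invfM mulrC//.
Qed.

(** * The Lambert quadrilateral *)

Lemma asin_complement {R : realType} (a : R) : 0 < a < 1 ->
  asin a - asin (- Num.sqrt (1 - a ^+ 2)) = pi / 2.
Proof.
move=> /andP[a0 a1].
have a11 : -1 <= a <= 1 by apply/andP; split; lra.
rewrite -cos_asin// (_ : - cos (asin a) = sin (asin a - pi / 2)); last first.
  by rewrite sinB cos_pihalf sin_pihalf mulr0 mulr1 sub0r.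
rewrite sinK; first by rewrite opprB addrC subrK.
have p0 := @pi_gt0 R.
have : asin a <= pi / 2 by exact: asin_lepi2.
have : 0 <= asin a.
  have [//|na] := leP 0 (asin a).
  have : sin (asin a) <= 0.
    rewrite -oppr_ge0 -sinN sin_ge0_pi// oppr_ge0 ltW//=.
    by have := asin_geNpi2 a11; lra.
  by rewrite asinK ?in_itv//=; lra.
by rewrite in_itv/=; lra.
Qed.

Lemma integral_asin {R : realType} (c r p q : R) : 0 < r ->
  c - r < p -> p < q -> q < c + r ->
  (\int[lebesgue_measure]_(u in `[p, q]) ((Num.sqrt (r ^+ 2 - (u - c) ^+ 2))^-1)%R%:E =
    (asin ((q - c) / r) - asin ((p - c) / r))%R%:E)%E.
Proof.
move=> r0 cp pq qc.
pose s (u : R) : R := r ^+ 2 - (u - c) ^+ 2.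
pose F (u : R) : R := asin ((u - c) / r).
have s0 u : p <= u <= q -> 0 < s u by rewrite /s; nra.
have ds (u : R) : is_derive u 1 s (- 2 * (u - c)).
  by apply: is_derive_eq; rewrite /GRing.scale/=; ring.
have contf (u : R) : p <= u <= q -> {for u, continuous (fun u : R => (Num.sqrt (s u))^-1)}.
  move=> /s0 su; apply: continuousV; first by rewrite sqrtr_eq0 -ltNge.
  apply: (@continuous_comp _ _ _ s Num.sqrt); last exact: sqrt_continuous.
  by apply/differentiable_continuous/derivable1_diffP; case: (ds u).
have dF (u : R) : p <= u <= q -> is_derive u 1 F ((Num.sqrt (s u))^-1).
  move=> upq; have /s0 su := upq.
  have du : -1 < (u - c) / r < 1.
    by rewrite ltr_pdivlMr// ltr_pdivrMr//; lra.
  have dlin : is_derive u 1 (fun u : R => (u - c) / r) r^-1.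
    by apply: is_derive_eq; rewrite /GRing.scale/=; ring.
  have h := @is_derive1_comp _ (@asin R) (fun u : R => (u - c) / r) u _ _
    (is_derive1_asin du) dlin.
  apply: is_derive_eq h _.
  have -> : 1 - ((u - c) / r) ^+ 2 = s u * (r ^+ 2)^-1.
    by rewrite /s; field; rewrite gt_eqF.
  rewrite sqrtrM ?(ltW su)// sqrtrV ?sqr_ge0// sqrtr_sqr gtr0_norm//.
  have A0 : 0 < Num.sqrt (s u) by rewrite sqrtr_gt0.
  by field; rewrite !gt_eqF.
have contF u : p <= u <= q -> {for u, continuous F}.
  by move=> /dF[Fx _]; exact/differentiable_continuous/derivable1_diffP.
rewrite EFinB; apply: (@continuous_FTC2 _ _ F) => //.
- apply: continuous_in_subspaceT => u; rewrite inE/= in_itv/=; exact: contf.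
- split.
  + move=> u; rewrite in_itv/= => /andP[/ltW y0 /ltW yb].
    by have /dF[] : p <= u <= q by rewrite y0.
  + by apply/cvg_at_right_filter/contF; rewrite lexx ltW.
  + by apply/cvg_at_left_filter/contF; rewrite lexx ltW.
- move=> u; rewrite in_itv/= => /andP[/ltW y0 /ltW yb].
  have /dF Fx : p <= u <= q by rewrite y0.
  by rewrite derive1E derive_val.
Qed.

(** In the half-plane the floor of the quadrilateral is an arc of the unit
    circle for u <= a, and for u >= a an arc of the circle of centre 1/a that
    represents the line x = a. The integrals of du/v along them are arcsines,
    that is, two complementary angles. *)
Lemma harea_lambert {R : realType} (a : R) : 0 < a < 1 -> harea (lambert a) = pi / 2.
Proof.
move=> a01; have /andP[a0 a1] := a01.
have ai : a < a^-1 by rewrite -[ltRHS]mul1r ltr_pdivlMr//; nra.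
(* y = 0 is the geodesic u^2 + v^2 = 1; x = a is u (1 - y) = a. *)
pose y0 (u : R) : R := if u <= a then 0 else 1 - a / u.
have den u : 0 <= u <= a^-1 -> y0 u < 1 /\ 0 < 1 + y0 u - u ^+ 2 * (1 - y0 u).
  move=> /andP[u0]; rewrite -[a^-1]mul1r ler_pdivlMr// => ua; rewrite /y0.
  case: ifPn => [ule|]; first by split; nra.
  rewrite -ltNge => ugt; have up : 0 < u by lra.
  split; first by rewrite gtrBl divr_gt0.
  have -> : 1 + (1 - a / u) - u ^+ 2 * (1 - (1 - a / u)) = ((u - a) + u * (1 - u * a)) / u.
    by field; rewrite gt_eqF.
  by rewrite divr_gt0//; nra.
have y0_ge0 u : 0 <= y0 u.
  rewrite /y0; case: ifPn => //; rewrite -ltNge => ua.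
  by rewrite subr_ge0 ler_pdivrMr ?mul1r ?ltW//; lra.
have mpiece : measurable (lambert a : set (plane R)).
  by do 3? [apply: measurableI; last exact: measurable_halfplane]; exact: measurable_halfplane.
have half1 x y : orient (A0 R) (A1 R) (x, y) = x by rewrite /orient/=; ring.
have half2 x y : orient (A1 R) (P1 a) (x, y) = a * y by rewrite /orient/=; ring.
have half3 x y : orient (P1 a) (P0 a) (x, y) = (1 - a ^+ 2) * (a - x).
  by rewrite /orient/=; ring.
have half4 x y : orient (P0 a) (A0 R) (x, y) = a * (1 - y - a * x) by rewrite /orient/=; ring.
have w0 : 0 < 1 - a ^+ 2 by nra.
have piece u y : lambert a (u * (1 - y), y) <-> 0 <= u <= a^-1 /\ y0 u <= y < 1.
  rewrite /lambert /halfplane/= half1 half2 half3 half4.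
  rewrite !(pmulr_rge0 _ a0) (pmulr_rge0 _ w0) subr_ge0/=.
  have key : 0 <= u -> (y0 u <= y) = ((0 <= y) && (u * (1 - y) <= a)).
    move=> u0; rewrite /y0; case: ifPn => [ua|].
      by have [y_ge0|//] := leP 0 y; apply/esym; nra.
    rewrite -ltNge => ua; have up : 0 < u by lra.
    have -> : (1 - a / u <= y) = (u * (1 - y) <= a).
      by rewrite lerBlDr -lerBlDl ler_pdivlMr// mulrC.
    by apply/idP/andP => [uy|[]//]; split=> //; nra.
  split.
    move=> [[[[/[dup] /hplane_lt1 y1 hp ux] [_ yy]] [_ xa]] [_]]; rewrite A0P0_cusp// => ua.
    have u0 : 0 <= u by rewrite -(pmulr_lge0 _ (_ : 0 < 1 - y)) ?subr_gt0.
    by rewrite ua y1 u0 key// yy xa.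
  move=> [/andP[u0 ua] /andP[yy y1]].
  have [_ d0] : y0 u < 1 /\ 0 < 1 + y0 u - u ^+ 2 * (1 - y0 u) by apply: den; rewrite u0.
  have hp : hplane (u * (1 - y), y).
    apply/hplane_cusp => //; apply: (lt_le_trans d0).
    by have := sqr_ge0 u; nra.
  move: yy; rewrite key// => /andP[yy xa].
  rewrite A0P0_cusp//; do ! split => //.
  by rewrite mulr_ge0// subr_ge0 ltW.
rewrite /harea /Rintegral (integral_area_cusp mpiece den _ piece); last first.
  by move=> [x y] [[[[/hplane_lt1]]]].
set v := (v in (\int[_]_(u in _) (v u)%:E)%E).
have mv : measurable_fun [set: R] v.
  have my0 : measurable_fun [set: R] y0.
    apply: measurable_fun_ifT => //.
      exact: measurable_fun_ler.
    apply: measurable_funB => //; apply: measurable_funM => //.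
    exact: measurable_invr.
  apply: (measurableT_comp (measurable_sqrtr R)); apply: measurable_funM.
    exact: measurable_funB.
  apply: (measurableT_comp (measurable_invr R)); apply: measurable_funB.
    exact: measurable_funD.
  by apply: measurable_funM; [exact: measurable_funX|exact: measurable_funB].
rewrite -(asin_complement a a01).
have -> : `[0, a^-1]%classic = `[0, a] `|` `]a, a^-1] :> set R.
  by rewrite -itv_bndbnd_setU// bnd_simp ltW.
rewrite ge0_integral_setU//; last 3 first.
- by apply/measurable_EFinP; exact: measurable_funS mv.
- by move=> u _; rewrite lee_fin sqrtr_ge0.
- apply/disj_setPS => u [] /=; rewrite !in_itv/= => /andP[_ ua] /andP[au _].
  by move: (lt_le_trans au ua); rewrite ltxx.
rewrite integral_itv_obnd_cbnd; last first.
  by apply/measurable_EFinP; exact: measurable_funS mv.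
(* The radius of the half-circle x = a in the (u, v) half-plane. *)
pose r := Num.sqrt (a^-1 ^+ 2 - 1).
have r2 : r ^+ 2 = a^-1 ^+ 2 - 1.
  by rewrite sqr_sqrtr// subr_ge0 expr_ge1// ?invr_ge0 ?ltW// invf_gt1.
have rE : r = Num.sqrt (1 - a ^+ 2) / a.
  rewrite /r (_ : a^-1 ^+ 2 - 1 = (1 - a ^+ 2) / a ^+ 2); last by field; rewrite gt_eqF.
  by rewrite sqrtrM ?(ltW w0)// sqrtrV ?sqr_ge0// sqrtr_sqr gtr0_norm.
have W0 : 0 < Num.sqrt (1 - a ^+ 2) by rewrite sqrtr_gt0.
have r0 : 0 < r by rewrite rE divr_gt0.
have -> : (\int[lebesgue_measure]_(u in `[0%R, a]) (v u)%:E = (asin a - asin 0)%:E)%E.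
  transitivity (\int[lebesgue_measure]_(u in `[0%R, a])
      ((Num.sqrt (1 ^+ 2 - (u - 0) ^+ 2))^-1)%R%:E)%E.
    apply: eq_integral => u; rewrite inE/= in_itv/= => /andP[u0 ua].
    rewrite /v /y0 ua !subr0 addr0 mulr1 mul1r expr1n sqrtrV//.
    by rewrite subr_ge0 expr_le1//; lra.
  by rewrite integral_asin ?subr0 ?divr1 ?mul0r//; lra.
have -> : (\int[lebesgue_measure]_(u in `[a, (a^-1)%R]) (v u)%:E =
    (asin 0 - asin (- Num.sqrt (1 - a ^+ 2)))%:E)%E.
  transitivity (\int[lebesgue_measure]_(u in `[a, (a^-1)%R])
      ((Num.sqrt (r ^+ 2 - (u - a^-1) ^+ 2))^-1)%R%:E)%E.
    apply: eq_integral => u; rewrite inE/= in_itv/= => /andP[au ua].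
    have u0 : 0 < u by lra.
    have y0E : y0 u = 1 - a / u.
      rewrite /y0; case: ifPn => // ua'.
      by rewrite (_ : u = a) ?divff ?subrr ?gt_eqF//; lra.
    have ua1 : u * a <= 1 by rewrite -ler_pdivlMr// mul1r.
    have d0 : 0 < (u - a) + u * (1 - u * a).
      have [->|ne] := eqVneq u a; first by nra.
      have : a < u by rewrite lt_neqAle eq_sym ne.
      by nra.
    rewrite /v y0E r2 -sqrtrV; last first.
      rewrite (_ : _ - _ = ((u - a) + u * (1 - u * a)) / a); last by field; rewrite gt_eqF.
      by rewrite divr_ge0// ltW.
    congr (Num.sqrt _)%:E.
    rewrite (_ : 1 + _ - _ = ((u - a) + u * (1 - u * a)) / u);
      last by field; rewrite gt_eqF.
    rewrite (_ : a^-1 ^+ 2 - 1 - _ = ((u - a) + u * (1 - u * a)) / a);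
      last by field; rewrite gt_eqF.
    by field; rewrite !gt_eqF.
  rewrite integral_asin//.
  - rewrite subrr mul0r (_ : (a - a^-1) / r = - Num.sqrt (1 - a ^+ 2))//.
    rewrite rE -[X in X - a^-1](_ : (1 - (Num.sqrt (1 - a ^+ 2)) ^+ 2) / a = a).
      by field; rewrite !gt_eqF.
    by rewrite sqr_sqrtr ?ltW//; field; rewrite gt_eqF.
  - have W2 : Num.sqrt (1 - a ^+ 2) ^+ 2 = 1 - a ^+ 2 by rewrite sqr_sqrtr// ltW.
    have -> : a^-1 - r = (1 - Num.sqrt (1 - a ^+ 2)) / a by rewrite rE mulrBl mul1r.
    have W1 : Num.sqrt (1 - a ^+ 2) < 1 by rewrite -[ltRHS]sqrtr1 ltr_sqrt//; nra.
    by rewrite ltr_pdivrMr//; nra.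
  - by rewrite ltrDl.
by rewrite -EFinD/= addrA subrK.
Qed.

(** * The density and its lower bound *)

Lemma meets_at_level {R : realType} (a t m : R) : 0 < a -> 0 < t ->
  meets_at a t m <-> [/\ 0 < m <= 1 - a ^+ 2, 0 < 1 - a ^+ 2 - m ^+ 2 &
    (1 - m) ^+ 2 * horo_level a t = 1 - a ^+ 2 - m ^+ 2].
Proof.
move=> a0 t0; set k := horo_level a t.
have c0 : (t * a ^+ 2) ^+ 2 != 0 by rewrite expf_neq0// mulf_neq0// ?expf_neq0// gt_eqF.
have qE : - lorentz (horo_pt a t) (horo_pt a t) = (t * a ^+ 2) ^+ 2 * k.
  by rewrite /k /horo_level /lorentz/=; field; rewrite !gt_eqF.
have cE : lorentz (horo_pt a t) (A0 R) ^+ 2 = (t * a ^+ 2) ^+ 2.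
  by rewrite /lorentz/=; ring.
have pE : - lorentz (a, m) (a, m) = 1 - a ^+ 2 - m ^+ 2 by rewrite /lorentz/=; ring.
have rE : lorentz (a, m) (A0 R) ^+ 2 = (1 - m) ^+ 2 by rewrite /lorentz/=; ring.
rewrite /meets_at /horocycle/= qE cE pE rE mulrCA.
split=> [[ma [/hplaneE T0 /(mulfI c0) mk]]|[ma T0 mk]]; first by split.
by split=> //; split; [exact/hplaneE|rewrite mk].
Qed.

(** Since (1 - m)^2 k = 1 - a^2 - m^2, the sinh of the height of M is
    m / ((1 - m) sqrt k), and 1 / sqrt k comes out of both areas. *)
Lemma density_eq {R : realType} (a t m : R) : 0 < a < 1 -> 0 < t ->
  meets_at a t m -> M a t = (a, m) ->
  0 < horo_level a t /\
  density a t = 2 / (pi * Num.sqrt (horo_level a t)) *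
    (m / (1 - m) * base_length a + a^-1).
Proof.
move=> a01 t0 mat ME; have /andP[a0 a1] := a01.
have [/andP[m0 ma] T0 mk] := (meets_at_level _ _ _ a0 t0).1 mat.
have m1 : 0 < 1 - m by nra.
have k0 : 0 < horo_level a t by rewrite -(pmulr_rgt0 _ (_ : 0 < (1 - m) ^+ 2)) ?mk// exprn_gt0.
split=> //.
rewrite /density (harea_lambert _ a01) (harea_hyper_piece _ _ _ a01 ME m0 T0).
rewrite harea_horo_piece//.
have r0 : 0 < Num.sqrt (horo_level a t) by rewrite sqrtr_gt0.
rewrite -mk sqrtrM ?sqr_ge0// sqrtr_sqr gtr0_norm//.
move: (@pi R) (@pi_gt0 R) => p p0; by field; rewrite !gt_eqF.
Qed.

(** With q = 1 - a^2 the bound reduces to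
    (1 - m q)^2 >= 3 (1 - q) (q - m^2). *)
Lemma density_ge {R : realType} (a t : R) : admissible a t ->
  Num.sqrt 12 / pi <= density a t.
Proof.
move=> [a01 /andP[t0 _] mex]; have /andP[a0 a1] := a01.
have := getPex mex; set m := get _ => mat.
have [k0 ->] := density_eq _ _ _ a01 t0 mat erefl.
have [/andP[m0 ma] T0 mk] := (meets_at_level _ _ _ a0 t0).1 mat.
have m1 : 0 < 1 - m by nra.
set k := horo_level a t in k0 mk *.
have r0 : 0 < Num.sqrt k by rewrite sqrtr_gt0.
have p0 := @pi_gt0 R.
have /andP[La _] := base_length_bounds _ a01.
set X := m / (1 - m) * base_length a + a^-1.
pose Y := m / (1 - m) * a + a^-1.
have Y0 : 0 < Y by rewrite addr_gt0 ?invr_gt0// mulr_gt0// divr_gt0.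
have YX : Y <= X by rewrite lerD2r ler_pM2l// divr_gt0.
apply: (@le_trans _ _ (2 * Y / (pi * Num.sqrt k))); last first.
  by rewrite mulrAC ler_pM2l// divr_gt0// mulr_gt0.
rewrite ler_pdivlMr ?mulr_gt0// mulrA divfK ?gt_eqF//.
have -> : Num.sqrt 12 * Num.sqrt k = Num.sqrt (12 * k) by rewrite [RHS]sqrtrM ?ler0n.
rewrite -[leRHS]ger0_norm; last by rewrite mulr_ge0// ltW.
rewrite -sqrtr_sqr ler_wsqrtr//.
(* Only base_length a >= a was used; what is left is algebraic in a and m. *)
have aY : a * (1 - m) * Y = 1 - m * (1 - a ^+ 2).
  by rewrite /Y; field; rewrite !gt_eqF.
have main : 3 * a ^+ 2 * ((1 - m) ^+ 2 * k) <= (a * (1 - m) * Y) ^+ 2.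
  rewrite aY mk; set q := 1 - a ^+ 2.
  have -> : a ^+ 2 = 1 - q by rewrite /q; ring.
  (* As a quadratic in m the difference has discriminant -12 (q - 1)^4, so
     it is nonnegative after completing the square. *)
  have d0 : 0 < q ^+ 2 - 3 * q + 3 by have := sqr_ge0 (q - 3 / 2); lra.
  rewrite -subr_ge0 -(pmulr_rge0 _ d0).
  rewrite [leRHS](_ : _ = ((q ^+ 2 - 3 * q + 3) * m - q) ^+ 2 +
    3 * ((q - 1) ^+ 2) ^+ 2); last by ring.
  by apply: addr_ge0; [exact: sqr_ge0|apply: mulr_ge0; [exact: ler0n|exact: sqr_ge0]].
have c0 : 0 < (a * (1 - m)) ^+ 2 by rewrite exprn_gt0// mulr_gt0.
rewrite -(ler_pM2l c0); move: main; rewrite !exprMn; nra.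
Qed.

(** * The limit for t = 8/7 *)

Lemma limit_value {R : realType} :
  2 / (pi * Num.sqrt (3 / 4)) * (2^-1 + 1) = Num.sqrt 12 / pi :> R.
Proof.
have s0 : 0 < Num.sqrt (3 / 4) :> R by rewrite sqrtr_gt0; lra.
have s2 : Num.sqrt (3 / 4) ^+ 2 = 3 / 4 :> R by rewrite sqr_sqrtr; lra.
have s12 : Num.sqrt 12 = 4 * Num.sqrt (3 / 4) :> R.
  have e12 : 12 = 4 ^+ 2 * (3 / 4) :> R by lra.
  by rewrite e12 sqrtrM ?sqr_ge0// sqrtr_sqr ger0_norm.
rewrite s12 (_ : 2^-1 + 1 = 2 * Num.sqrt (3 / 4) ^+ 2); last by rewrite s2; lra.
move: (@pi R) (@pi_gt0 R) => p p0; by field; rewrite !gt_eqF.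
Qed.

Lemma horo_level_eight_sevenths {R : realType} (a : R) : 0 < a ->
  horo_level a (8 / 7) = (3 / 4 - a ^+ 2) / a ^+ 2.
Proof. by move=> a0; rewrite /horo_level; field; rewrite gt_eqF. Qed.

(** For t = 8/7 the equation of the horocycle on the line x = a splits as
    (3 (1 - m) - 2 a^2) (1 - m - 2 a^2) = 0. *)
Lemma meets_at_eight_sevenths {R : realType} (a m : R) : 0 < a < 1 / 2 ->
  meets_at a (8 / 7) m <-> m = 1 - 2 * a ^+ 2.
Proof.
move=> /andP[a0 a2]; have t0 : 0 < 8 / 7 :> R by lra.
have b0 : 0 < a ^+ 2 by rewrite exprn_gt0.
have b1 : a ^+ 2 < 1 / 4 by nra.
rewrite meets_at_level// horo_level_eight_sevenths//; split.
  move=> [/andP[m0 ma] _ mk].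
  (* The factor 3 (1 - m) - 2 a^2 vanishes only beyond P0. *)
  have : (3 * (1 - m) - 2 * a ^+ 2) * (1 - m - 2 * a ^+ 2) = 0.
    have : (1 - m) ^+ 2 * (3 / 4 - a ^+ 2) = (1 - a ^+ 2 - m ^+ 2) * a ^+ 2.
      by rewrite -mk; field; rewrite gt_eqF.
    by nra.
  by move=> /eqP; rewrite mulf_eq0 => /orP[] /eqP; lra.
move=> ->; split; [by apply/andP; split; lra|by nra|].
by field; rewrite gt_eqF.
Qed.

Lemma admissible_eight_sevenths {R : realType} (a : R) : 0 < a < 1 / 2 -> admissible a (8 / 7).
Proof.
move=> a01; have /andP[a0 a2] := a01; split.
- by rewrite a0; lra.
- apply/andP; split; first by lra.
  have b1 : a ^+ 2 < 1 / 4 by nra.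
  have b0 : 0 < a ^+ 2 by rewrite exprn_gt0.
  have -> : a ^+ 4 = (a ^+ 2) ^+ 2 by rewrite -exprM.
  by rewrite ltr_pdivlMr; nra.
- by exists (1 - 2 * a ^+ 2); apply/meets_at_eight_sevenths.
Qed.

Lemma density_eight_sevenths {R : realType} (a : R) : 0 < a < 1 / 2 ->
  density a (8 / 7) = 2 / (pi * Num.sqrt (3 / 4 - a ^+ 2)) *
    ((1 - 2 * a ^+ 2) / 2 * (base_length a / a) + 1).
Proof.
move=> a01; have /andP[a0 a2] := a01.
have t0 : 0 < 8 / 7 :> R by lra.
have b1 : a ^+ 2 < 1 / 4 by nra.
have a1 : 0 < a < 1 by rewrite a0; lra.
have [_ _ /getPex] := admissible_eight_sevenths _ a01.
have ME : M a (8 / 7) = (a, get [set m | meets_at a (8 / 7) m]) by [].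
move: ME; set m := get _ => ME mat.
have [k0 ->] := density_eq _ _ _ a1 t0 mat ME.
have -> : m = 1 - 2 * a ^+ 2 by apply/(meets_at_eight_sevenths _ _ a01).
rewrite horo_level_eight_sevenths// sqrtrM; last lra.
rewrite sqrtrV ?sqr_ge0// sqrtr_sqr gtr0_norm//.
have r0 : 0 < Num.sqrt (3 / 4 - a ^+ 2) by rewrite sqrtr_gt0; lra.
have e0 : 1 - (1 - 2 * a ^+ 2) != 0 by rewrite subKr mulf_neq0 ?expf_neq0// gt_eqF.
move: (@pi R) (@pi_gt0 R) => p p0; by field; rewrite e0 !gt_eqF.
Qed.

Lemma density_eight_sevenths_cvg {R : realType} :
  density a (8 / 7 : R) @[a --> 0^'+] --> (Num.sqrt 12 / pi : R).
Proof.
have near_small : \forall a \near (0 : R)^'+, 0 < a < 1 / 2.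
  near=> a; apply/andP; split; near: a;
    first exact: nbhs_right_gt.
  by apply: nbhs_right_lt; lra.
have sq_cvg : (a : R) ^+ 2 @[a --> 0^'+] --> (0 : R).
  rewrite -[X in _ --> X](expr0n R 2).
  by apply: cvg_at_right_filter; exact: exprn_continuous.
have length_cvg : base_length a / a @[a --> (0 : R)^'+] --> (1 : R).
  have up : (1 - (a : R) ^+ 2)^-1 @[a --> 0^'+] --> (1 : R).
    rewrite -[X in _ --> X]invr1; apply: cvgV; first exact: oner_neq0.
    by rewrite -[X in _ --> X]subr0; apply: cvgB; [exact: cvg_cst|].
  apply: (squeeze_cvgr (f := cst 1) (h := fun a : R => (1 - a ^+ 2)^-1)) => //;
    last exact: cvg_cst.
  apply: filterS near_small => a /andP[a0 a2].
  have /andP[lo hi] : a <= base_length a <= a / (1 - a ^+ 2).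
    by apply: base_length_bounds; rewrite a0; lra.
  by rewrite ler_pdivlMr// mul1r lo ler_pdivrMr// mulrC hi.
rewrite -limit_value.
have : 2 / (pi * Num.sqrt (3 / 4 - a ^+ 2)) *
    ((1 - 2 * a ^+ 2) / 2 * (base_length a / a) + 1) @[a --> (0 : R)^'+] -->
    (2 / (pi * Num.sqrt (3 / 4)) * (2^-1 + 1) : R).
  apply: cvgM.
    apply: cvgM; first exact: cvg_cst.
    apply: cvgV.
      by rewrite mulf_neq0// gt_eqF ?pi_gt0// sqrtr_gt0; lra.
    apply: cvgM; first exact: cvg_cst.
    apply: continuous_cvg; first exact: sqrt_continuous.
    by rewrite -[X in _ --> X]subr0; apply: cvgB; [exact: cvg_cst|].
  apply: cvgD; last exact: cvg_cst.
  rewrite -[X in _ --> X]mulr1; apply: cvgM => //.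
  rewrite -[X in _ --> X]mul1r; apply: cvgM; last exact: cvg_cst.
  rewrite -[X in _ --> X]subr0; apply: cvgB; first exact: cvg_cst.
  by rewrite -[X in _ --> X](mulr0 2); apply: cvgM; [exact: cvg_cst|].
apply: cvg_trans; apply: near_eq_cvg.
by apply: filterS near_small => a /density_eight_sevenths ->.
Unshelve. all: by end_near. Qed.

Theorem theorem3p3 (R : realType) :
  [/\ has_inf (densities R) /\ inf (densities R) = Num.sqrt 12 / pi,
      exists t0 : R,
        [/\ 1142 / 1000 <= t0 < 1143 / 1000,
            \forall a \near 0^'+, admissible a t0 &
            density a t0 @[a --> 0^'+] --> (Num.sqrt 12 / pi : R)] &
      forall e : R, 0 < e -> exists a t : R,
        admissible a t /\ `|density a t - Num.sqrt 12 / pi| < e].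
Proof.
have near_adm : \forall a \near (0 : R)^'+, admissible a (8 / 7).
  near=> a; apply: admissible_eight_sevenths; apply/andP; split; near: a;
    first exact: nbhs_right_gt.
  by apply: nbhs_right_lt; lra.
have approach (e : R) : 0 < e -> exists a t : R,
    admissible a t /\ `|density a t - Num.sqrt 12 / pi| < e.
  move=> e0.
  have [a [adm close]] : exists a, admissible a (8 / 7) /\
      `|Num.sqrt 12 / pi - density a (8 / 7)| < e.
    near (0 : R)^'+ => a; exists a; split; first by near: a.
    by near: a; move/cvgrPdist_lt: (@density_eight_sevenths_cvg R); exact.
  by exists a, (8 / 7); rewrite distrC.
have lb : lbound (densities R) (Num.sqrt 12 / pi).
  by move=> _ [a [t [adm ->]]]; exact: density_ge.
have [a1 [t1 [adm1 _]]] := approach 1 ltr01.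
have ne : densities R !=set0 by exists (density a1 t1), a1, t1.
split=> //; last first.
  by exists (8 / 7); split => //; [apply/andP; split; lra|exact: density_eight_sevenths_cvg].
split; first by split=> //; exists (Num.sqrt 12 / pi).
apply/eqP; rewrite eq_le lb_le_inf// andbT; apply/ler_addgt0Pr => e e0.
have [a [t [adm]]] := approach e e0.
rewrite ltr_distl => /andP[_ /ltW]; apply: le_trans.
by apply: ge_inf; [exists (Num.sqrt 12 / pi)|exists a, t].
Unshelve. all: by end_near. Qed.
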